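(* Let $\Bbbk$ be a field, $V$ a vector space of dimension $d$ over $\Bbbk$, $G$ a subgroup of $\mathrm{GL}_d(\Bbbk)$ (acting on $V=\Bbbk^d$ in the usual way), and $Q = V\times G$. For $n\in\mathbb{Z}$ define $$(a,A)\circ_n (b,B) = (A^n b,\ A^n B A^{-n}),\qquad a,b\in V,\ A,B\in G,$$ and let $*_n^{op}$ be the opposite operation $$(a,A) *_n^{op} (b,B) = (b,B)\circ_n (a,A).$$ Then $(Q, *_n^{op}, n\in\mathbb{Z})$ is a rack system.
   Context: A rack is a non-empty set $Q$ with a binary operation $*$ such that: (Q2) for any $x,y\in Q$ there exists a unique $z\in Q$ with $x = z*y$; (Q3) $(x*y)*z = (x*z)*(y*z)$ for all $x,y,z\in Q$. A rack system is a set $Q$ with a family of binary operations $(Q, *_i, i\in I)$ such that $(Q,*_i)$ is a rack for every $i\in I$. *)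

(* Defs.v *)
From mathcomp Require Import all_boot all_algebra.
From mathcomp Require Import classical_sets.

Set Implicit Arguments.
Unset Strict Implicit.
Unset Printing Implicit Defensive.

Import GRing.Theory.
Local Open Scope classical_set_scope.
Local Open Scope ring_scope.

(* A set carrying an operation is represented as a subset Q of an ambient     *)
(* type T; the operation is given on T, and being an operation on Q means     *)
(* that Q is closed under it.  Its values outside Q are irrelevant.           *)
Record is_rack (T : Type) (Q : set T) (op : T -> T -> T) : Prop := IsRack {
  rack_nonempty : Q !=set0;
  rack_closed : forall x y, Q x -> Q y -> Q (op x y);
  rack_Q2 : forall x y, Q x -> Q y -> exists! z, Q z /\ x = op z y;
  rack_Q3 : forall x y z, Q x -> Q y -> Q z ->
    op (op x y) z = op (op x z) (op y z)
}.

Definition is_rack_system (T I : Type) (Q : set T) (op : I -> T -> T -> T) :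
  Prop := forall i, is_rack Q (op i).

Record is_subgroup_GL (k : fieldType) (d : nat) (G : set 'M[k]_d) : Prop :=
  IsSubgroupGL {
    subgroup_unit : forall A, G A -> A \in unitmx;
    subgroup_one : G 1%:M;
    subgroup_mul : forall A B, G A -> G B -> G (A *m B);
    subgroup_inv : forall A, G A -> G (invmx A)
  }.

(* The library's exprz needs a unit ring structure, which square matrices     *)
(* only have in positive dimension; this version also covers d = 0.           *)
Definition mxexpz (k : fieldType) (d : nat) (A : 'M[k]_d) (n : int) : 'M[k]_d :=
  match n with
  | Posz m => A ^+ m
  | Negz m => invmx (A ^+ m.+1)
  end.

Definition circ (k : fieldType) (d : nat) (n : int)
    (x y : 'cV[k]_d * 'M[k]_d) : 'cV[k]_d * 'M[k]_d :=
  (mxexpz x.2 n *m y.1, mxexpz x.2 n *m y.2 *m mxexpz x.2 (- n)).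

Definition star_op (k : fieldType) (d : nat) (n : int)
    (x y : 'cV[k]_d * 'M[k]_d) : 'cV[k]_d * 'M[k]_d :=
  circ n y x.

(* Main.v *)
Require Import Defs.
From mathcomp Require Import all_boot all_algebra.
From mathcomp Require Import classical_sets.

Import GRing.Theory.
Local Open Scope classical_set_scope.
Local Open Scope ring_scope.

(** The group G acts on V * G by P . (a, A) = (P a, P A P^-1), and the
    operation is x * y = B^n . x for y = (b, B): right multiplication by y is
    the action of B^n, an element of G ([star_opE]).

    Right multiplications are therefore bijections of V * G, which is the
    existence and uniqueness of right quotients.  For self-distributivity, let
    z = (c, C).  The matrix component of y * z is C^n B C^-n, whose n-th power
    is C^n B^n C^-n because conjugation is multiplicative ([mxexpz_conj]).
    Hence (x * z) * (y * z) = (C^n B^n C^-n) . C^n . x = C^n . B^n . x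
    = (x * y) * z. *)

Section MatrixPowers.
Context {k : fieldType} {d : nat}.
Implicit Types (A B P : 'M[k]_d) (n : int).

Lemma unitmx_exp A m : A \in unitmx -> A ^+ m \in unitmx.
Proof.
move=> uA; elim: m => [|m IHm]; first by rewrite expr0 unitmx1.
by rewrite exprS unitmx_mul uA.
Qed.

Lemma unitmx_expz A n : A \in unitmx -> mxexpz A n \in unitmx.
Proof. by case: n => m uA /=; rewrite ?unitmx_inv unitmx_exp. Qed.

(** For n < 0 the left-hand side is a power with the inverse removed; [invmx]
    undoes itself on every matrix, being the identity on singular ones. *)
Lemma mxexpzN A n : mxexpz A (- n) = invmx (mxexpz A n).
Proof. by case: n => [[|m]|m] //=; rewrite ?expr0 ?invmx1 ?invmxK. Qed.

Lemma invmx_mul A B : A \in unitmx -> B \in unitmx ->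
  invmx (A *m B) = invmx B *m invmx A.
Proof.
move=> uA uB; have uAB : A *m B \in unitmx by rewrite unitmx_mul uA.
by rewrite -[RHS](mulmxK uAB) mulmxA mulmxKV // mulVmx // mul1mx.
Qed.

Lemma mx_conj_exp P A m : P \in unitmx ->
  (P *m A *m invmx P) ^+ m = P *m A ^+ m *m invmx P.
Proof.
move=> uP; elim: m => [|m IHm]; first by rewrite !expr0 mulmx1 mulmxV.
by rewrite !exprS IHm -!mulmxE !mulmxA mulmxKV.
Qed.

Lemma mxexpz_conj P A n : P \in unitmx -> A \in unitmx ->
  mxexpz (P *m A *m invmx P) n = P *m mxexpz A n *m invmx P.
Proof.
case: n => m uP uA /=; rewrite mx_conj_exp //.
by rewrite !invmx_mul ?unitmx_mul ?unitmx_inv ?unitmx_exp ?uP // invmxK mulmxA.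
Qed.

End MatrixPowers.

Section ConjugationAction.
Context {k : fieldType} {d : nat}.
Implicit Types (x y : 'cV[k]_d * 'M[k]_d) (P R : 'M[k]_d) (n : int).

Definition conj_act P x : 'cV[k]_d * 'M[k]_d := (P *m x.1, P *m x.2 *m invmx P).

Lemma star_opE n x y : star_op n x y = conj_act (mxexpz y.2 n) x.
Proof. by rewrite /star_op /circ mxexpzN. Qed.

Lemma conj_actM P R x : P \in unitmx -> R \in unitmx ->
  conj_act P (conj_act R x) = conj_act (P *m R) x.
Proof. by move=> uP uR; rewrite /conj_act /= invmx_mul // !mulmxA. Qed.

Lemma conj_act1 x : conj_act 1%:M x = x.
Proof. by case: x => a A; rewrite /conj_act /= invmx1 !mul1mx mulmx1. Qed.

Lemma conj_actK P : P \in unitmx -> cancel (conj_act P) (conj_act (invmx P)).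
Proof.
by move=> uP x; rewrite conj_actM ?unitmx_inv // mulVmx // conj_act1.
Qed.

Lemma conj_actVK P : P \in unitmx -> cancel (conj_act (invmx P)) (conj_act P).
Proof.
by move=> uP x; rewrite conj_actM ?unitmx_inv // mulmxV // conj_act1.
Qed.

Lemma star_op_distr n x y z : y.2 \in unitmx -> z.2 \in unitmx ->
  star_op n (star_op n x y) z = star_op n (star_op n x z) (star_op n y z).
Proof.
move=> uB uC; have uBn := unitmx_expz _ n uB; have uCn := unitmx_expz _ n uC.
rewrite !star_opE /= mxexpz_conj // !conj_actM ?mulmxKV //.
by rewrite !unitmx_mul unitmx_inv uCn uBn.
Qed.

End ConjugationAction.

Section Subgroup.
Context {k : fieldType} {d : nat} {G : set 'M[k]_d} (hG : is_subgroup_GL G).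

Lemma subgroup_expz A n : G A -> G (mxexpz A n).
Proof.
move=> GA; have GX m : G (A ^+ m).
  elim: m => [|m IHm]; first exact: subgroup_one hG.
  by rewrite exprS; apply: (subgroup_mul hG).
by case: n => m //=; apply: (subgroup_inv hG).
Qed.

Lemma conj_act_closed P x : G P -> G x.2 ->
  ([set: 'cV[k]_d] `*` G) (conj_act P x).
Proof.
move=> GP GA; split=> //=.
by apply: (subgroup_mul hG); [apply: (subgroup_mul hG) | apply: (subgroup_inv hG)].
Qed.

End Subgroup.

Theorem corollary4p4 (k : fieldType) (d : nat) (G : set 'M[k]_d)
    (hG : is_subgroup_GL G) :
  is_rack_system ([set: 'cV[k]_d] `*` G) (fun n : int => @star_op k d n).
Proof.
move=> n; split.
- by exists (0, 1%:M); split=> //; apply: subgroup_one hG.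
- move=> x y [_ Gx] [_ Gy]; rewrite star_opE.
  exact: (conj_act_closed hG _ _ (subgroup_expz hG _ n Gy) Gx).
- move=> x y [_ Gx] [_ Gy]; have GP := subgroup_expz hG _ n Gy.
  have uP := subgroup_unit hG GP.
  exists (conj_act (invmx (mxexpz y.2 n)) x); split.
    split; last by rewrite star_opE conj_actVK.
    exact: (conj_act_closed hG _ _ (subgroup_inv hG GP) Gx).
  by move=> z [_ ->]; rewrite star_opE conj_actK.
- move=> x y z _ [_ Gy] [_ Gz].
  exact: star_op_distr (subgroup_unit hG Gy) (subgroup_unit hG Gz).
Qed.
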